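(* There exist two infinite sets $A$ and $M$ of positive integers such that $p(n,A,M)=1$ for every positive integer $n$.
   Context: For sets $A$, $M$ of positive integers and a positive integer $n$, $p(n,A,M)$ denotes the number of representations of $n$ in the form $n=\sum_{a\in A} m_a a$, where $m_a\in M\cup\{0\}$ for every $a\in A$ and all but finitely many $m_a$ equal $0$ (two representations are different if their coefficient families $(m_a)_{a\in A}$ differ). *)

(* Defs.v *)
From HB Require Import structures.
From mathcomp Require Import all_boot finmap.
From mathcomp Require Import boolp classical_sets functions cardinality.

Set Implicit Arguments.
Unset Strict Implicit.
Unset Printing Implicit Defensive.

Local Open Scope classical_set_scope.
Local Open Scope nat_scope.

Notation coefs := {fsfun nat -> nat with 0}.

(* A family (m_a)_{a in A} with almost all m_a zero is encoded by its
   extension by zero to all of nat, a finitely supported function; the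
   requirement that m a = 0 outside A makes this encoding one-to-one. *)
Definition representations (n : nat) (A M : set nat) : set coefs :=
  [set m : coefs | [/\ forall a, A a -> (M `|` [set 0]) (m a),
                       forall a, ~ A a -> m a = 0 &
                       n = \sum_(a <- finsupp m) m a * a]].

(* fset_set is only meaningful on finite sets; see finite_representations. *)
Definition p (n : nat) (A M : set nat) : nat :=
  #|` fset_set (representations n A M)|.

Lemma finite_representations (n : nat) (A M : set nat) :
  (forall a, A a -> 0 < a) -> finite_set (representations n A M).
Proof.
move=> A0.
have bnd (m : coefs) a : representations n A M m -> a \in finsupp m -> m a * a <= n.
  by move=> [_ _ ->] am; rewrite (big_fsetD1 a)//= leq_addr.
have supp (m : coefs) a : representations n A M m -> m a != 0 -> 0 < a <= n /\ m a <= n.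
  move=> rm ma0.
  have a0 : 0 < a.
    by apply: A0; apply: contrapT => Aa; case: rm ma0 => _ /(_ _ Aa) ->.
  have h : m a * a <= n by apply: bnd => //; rewrite mem_finsupp.
  split; last by apply: leq_trans h; rewrite leq_pmulr.
  by rewrite a0 /=; apply: leq_trans h; rewrite leq_pmull// lt0n.
pose F (m : coefs) : {ffun 'I_n.+1 -> 'I_n.+1} :=
  [ffun i => inord (m (val i))].
suff inj : {in representations n A M &, injective F}.
  rewrite -(eq_finite_set (inj_card_eq inj)).
  exact: sub_finite_set (@subsetT _ _) (@finite_finset _ _).
move=> m1 m2 /set_mem r1 /set_mem r2 e; apply/fsfunP => a.
have le (m : coefs) : representations n A M m -> m a < n.+1.
  by move=> r; have [->//|/(supp _ _ r)[]] := eqVneq (m a) 0.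
have [an|an] := ltnP a n.+1; last first.
  have z (m : coefs) : representations n A M m -> m a = 0.
    move=> r; apply/eqP/contraT => /(supp _ _ r)[/andP[_ an']].
    by rewrite leqNgt in an'; rewrite an in an'.
  by rewrite !z.
have /(congr1 val) := congr1 (fun f : {ffun 'I_n.+1 -> 'I_n.+1} => f (Ordinal an)) e.
by rewrite !ffunE /= !inordK // le.
Qed.

(* Main.v *)
Require Import Defs.
From mathcomp Require Import all_boot finmap zify.
From mathcomp Require Import boolp classical_sets functions cardinality.

(** Let S (resp. T) be the set of naturals whose binary digits 1 all sit at
    even (resp. odd) positions: both are infinite, and every k is uniquely
    s + t with s in S and t in T.  Take A = {2^s | s in S}, and for M the
    nonzero numbers all of whose binary digits 1 sit at positions in T.  In
    n = \sum_s m_s 2^s, digit t of m_s contributes 2^(s+t), so it must be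
    digit s + t of n: the representation is read off the binary expansion. *)

Local Open Scope classical_set_scope.
Local Open Scope nat_scope.

(** * Binary digits *)

Definition bit (n k : nat) : bool := odd (n %/ 2 ^ k).

Lemma bitS n k : bit n k.+1 = bit n./2 k.
Proof. by rewrite /bit expnS divnMA divn2. Qed.

(** The term at 0 gives the parity, and the rest is twice a sum of the same kind for the shifted
    [f], so induction on [N] applies. *)
Lemma bit_sum (f : nat -> bool) N k :
  bit (\sum_(i < N) f i * 2 ^ i) k = (k < N) && f k.
Proof.
elim: N f k => [|N IH] f k; first by rewrite big_ord0 /bit div0n.
rewrite big_ord_recl /= muln1.
under eq_bigr do rewrite /bump /= add1n expnS mulnCA.
rewrite -big_distrr /= mul2n; case: k => [|k].
  by rewrite /bit divn1 oddD odd_double addbF oddb.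
by rewrite bitS half_bit_double (IH (f \o succn)).
Qed.

Lemma sum_bit n N : n <= N -> \sum_(i < N) bit n i * 2 ^ i = n.
Proof.
elim: N n => [|N IH] n nN; first by rewrite big_ord0; lia.
rewrite big_ord_recl /= muln1.
under eq_bigr do rewrite /bump /= add1n expnS mulnCA bitS.
by rewrite -big_distrr /= IH ?mul2n 1?/bit ?divn1 ?odd_double_half//; lia.
Qed.

Lemma bit_le n k : bit n k -> 2 ^ k <= n.
Proof. by rewrite leqNgt /bit; apply: contraL => /divn_small ->. Qed.

Lemma bit_lt n k : bit n k -> k < n.
Proof. by move/bit_le; apply: leq_trans; exact: ltn_expl. Qed.

Lemma bit_inj : injective bit.
Proof.
move=> m n e; rewrite -(sum_bit m (m + n)) ?leq_addr//.
by rewrite -[RHS](sum_bit n (m + n)) ?leq_addl// e.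
Qed.

(** * Numbers with digits at prescribed positions *)

(** Stopping at [n] loses nothing: a digit 1 at position [k] forces [k < n]. *)
Definition mask (P : pred nat) (n : nat) := \sum_(i < n) (P i && bit n i) * 2 ^ i.

(** Boolean, so that [bits_in P] can itself serve as a set of positions, as it does in
    [coef_set]. *)
Definition bits_in (P : pred nat) (n : nat) : bool := mask P n == n.

Lemma bit_mask (P : pred nat) n k : bit (mask P n) k = P k && bit n k.
Proof.
rewrite /mask (bit_sum (fun i => P i && bit n i)).
by case: (boolP (bit n k)) => [/bit_lt ->|]; rewrite ?andbF.
Qed.

Lemma bits_inP (P : pred nat) n : reflect (forall k, bit n k -> P k) (bits_in P n).
Proof.
apply: (iffP eqP) => [<- k|h]; first by rewrite bit_mask => /andP[].
apply: bit_inj; apply/funext => k; rewrite bit_mask.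
by case: (boolP (bit n k)) => [/h ->|]; rewrite ?andbF.
Qed.

Lemma bits_in_mask (P : pred nat) n : bits_in P (mask P n).
Proof. by apply/bits_inP => k; rewrite bit_mask => /andP[]. Qed.

Lemma bits_in_exp2 (P : pred nat) k : P k -> bits_in P (2 ^ k).
Proof.
move=> Pk; apply/bits_inP => j.
have -> : 2 ^ k = \sum_(i < k.+1) (i == k :> nat) * 2 ^ i.
  rewrite big_ord_recr /= eqxx mul1n big1// => i _.
  by rewrite (ltn_eqF (ltn_ord i)).
by rewrite (bit_sum (fun i => i == k)) => /andP[_ /eqP ->].
Qed.

Lemma maskD (P : pred nat) n : mask P n + mask (predC P) n = n.
Proof.
rewrite -[RHS](sum_bit n n)// /mask -big_split; apply: eq_bigr => i _ /=.
by rewrite -mulnDl; case: (P i); rewrite /= ?addn0.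
Qed.

(** The digits 1 of [s] and [t] sit at disjoint positions, so the addition has no carry. *)
Lemma bit_add (P : pred nat) s t k : bits_in P s -> bits_in (predC P) t ->
  bit (s + t) k = if P k then bit s k else bit t k.
Proof.
move=> /bits_inP sP /bits_inP tP.
have [N sN tN] : exists2 N, s <= N & t <= N.
  by exists (s + t); rewrite ?leq_addr ?leq_addl.
have -> : s + t = \sum_(i < N) (bit s i || bit t i) * 2 ^ i.
  rewrite -{1}(sum_bit s N)// -{1}(sum_bit t N)// -big_split.
  apply: eq_bigr => i _ /=; rewrite -mulnDl.
  case: (boolP (bit s i)) => [/sP Pi|_]; last by rewrite add0n.
  by case: (boolP (bit t i)) => // /tP; rewrite /= Pi.
rewrite (bit_sum (fun i => bit s i || bit t i)).
case: (boolP (bit s k)) => [sk|_].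
  by rewrite (sP _ sk) (leq_trans (bit_lt _ _ sk)).
case: (boolP (bit t k)) => [tk|_]; last by rewrite andbF if_same.
by rewrite (negbTE (tP _ tk)) (leq_trans (bit_lt _ _ tk)).
Qed.

(** With [maskC_add] and [maskD], this makes [k = s + t] a bijection between such pairs and the
    naturals. *)
Lemma mask_add (P : pred nat) s t : bits_in P s -> bits_in (predC P) t -> mask P (s + t) = s.
Proof.
move=> sP tP; apply: bit_inj; apply/funext => k.
rewrite bit_mask (bit_add P)//; move/bits_inP: sP => /(_ k).
by case: (P k) => // h; symmetry; apply/negP => /h.
Qed.

Lemma maskC_add (P : pred nat) s t :
  bits_in P s -> bits_in (predC P) t -> mask (predC P) (s + t) = t.
Proof.
by move=> sP tP; have := maskD P (s + t); rewrite mask_add// => /addnI.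
Qed.

(** * Sums of powers of 2 over exponents *)

(** Group by [k = s + t]: only the pair of masks of [k] contributes to [2 ^ k], so the right side is
    a genuine binary expansion. *)
Lemma sum_exp2_mask (P : pred nat) (g : nat -> nat -> bool) N :
  (forall s t, g s t ->
    [/\ bits_in P s, bits_in (predC P) t, s < N & t < N]) ->
  \sum_(s < N) (\sum_(t < N) g s t * 2 ^ t) * 2 ^ s =
  \sum_(k < N + N) g (mask P k) (mask (predC P) k) * 2 ^ k.
Proof.
move=> gP.
under eq_bigr do rewrite big_distrl /=.
(* The indicator of [k = s + t] lets the sum over [k] move outermost. *)
transitivity (\sum_(s < N) \sum_(t < N) \sum_(k < N + N)
    g s t * (k == s + t :> nat) * 2 ^ k).
  apply: eq_bigr => s _; apply: eq_bigr => t _.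
  have kP : s + t < N + N by have := ltn_ord s; have := ltn_ord t; lia.
  rewrite (bigD1 (Ordinal kP)) //= eqxx muln1 big1 ?addn0.
    by rewrite -mulnA -expnD addnC.
  by move=> k; rewrite -val_eqE /= => /negbTE ->; rewrite muln0.
under eq_bigr do rewrite exchange_big /=.
rewrite exchange_big /=; apply: eq_bigr => k _.
have z s t : g s t -> k = s + t :> nat -> s = mask P k /\ t = mask (predC P) k.
  by move=> /gP[sS tT _ _] ->; rewrite mask_add// maskC_add.
have [gk|gk] := boolP (g (mask P k) (mask (predC P) k)).
  have [_ _ sN tN] := gP _ _ gk.
  rewrite (bigD1 (Ordinal sN))//= (bigD1 (Ordinal tN))//= gk maskD eqxx.
  rewrite !big1 ?addn0// => [s|t].
    rewrite -val_eqE /= => /eqP ne; apply: big1 => t _.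
    case: (boolP (g s t)) => // gst; case: eqP => //= e.
    by have [] := z _ _ gst e.
  rewrite -val_eqE /= => /eqP ne.
  case: (boolP (g _ t)) => // gst; case: eqP => //= e.
  by have [] := z _ _ gst e.
apply: big1 => s _; apply: big1 => t _.
case: (boolP (g s t)) => // gst; case: eqP => //= e.
by have [es et] := z _ _ gst e; rewrite es et (negbTE gk) in gst.
Qed.

Lemma sum_finsupp_exp2 (m : coefs) N :
  (forall a, m a != 0 -> exists2 s, s < N & a = 2 ^ s) ->
  \sum_(a <- finsupp m) m a * a = \sum_(s < N) m (2 ^ s) * 2 ^ s.
Proof.
move=> mN; rewrite -(big_mkord xpredT (fun s => m (2 ^ s) * 2 ^ s)).
(* Zero coefficients are dropped first, so that the remaining exponents match the support
   exactly. *)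
rewrite [RHS](bigID (fun s => m (2 ^ s) == 0)) /= [in RHS]big1 ?add0n; last first.
  by move=> s /eqP ms; rewrite ms.
rewrite -[RHS]big_filter.
rewrite -[RHS](big_map (fun s => 2 ^ s) xpredT (fun a => m a * a)).
apply: perm_big; apply: uniq_perm; first exact: fset_uniq.
  rewrite map_inj_uniq ?filter_uniq ?iota_uniq//.
  by move=> x y /eqP; rewrite eqn_exp2l// => /eqP.
move=> a; rewrite mem_finsupp; apply/idP/mapP => [ma|[s]].
  have [s sN e] := mN _ ma.
  by exists s => //; rewrite mem_filter mem_index_iota sN -e ma.
by rewrite mem_filter => /andP[ms _] ->.
Qed.

Lemma infinite_set_range (f : nat -> nat) (X : set nat) :
  injective f -> (forall n, X (f n)) -> infinite_set X.
Proof.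
move=> fI fX Xfin; apply: infinite_nat.
have -> : [set: nat] = f @^-1` X by apply/seteqP; split => // n _; exact: fX.
by apply: finite_preimage => // x y _ _ /fI.
Qed.

(** * The sets A and M *)

Definition positions_S : pred nat := bits_in (predC odd).
(** The double complement is the form that [predC P] takes at [P := predC odd]. *)
Definition positions_T : pred nat := bits_in (predC (predC odd)).
Definition base_set : set nat := [set 2 ^ s | s in [set s | positions_S s]].
Definition coef_set : set nat := [set m | 0 < m /\ bits_in positions_T m].

(** This gives uniqueness: the right side does not involve [m]. *)
Lemma representation_bit n (m : coefs) s t :
  representations n base_set coef_set m ->
  positions_S s -> bit (m (2 ^ s)) t = positions_T t && bit n (s + t).
Proof.
move=> [mA mN en] Ss.
have supp a : m a != 0 -> exists2 s, positions_S s & a = 2 ^ s.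
  move=> ma0; have [[s' /= Ss' <-]|/mN ma] := pselect (base_set a); last first.
    by rewrite ma in ma0.
  by exists s'.
have le a : m a != 0 -> m a * a <= n.
  by move=> ma; rewrite en (big_fsetD1 a) ?mem_finsupp//= leq_addr.
have mT s' t' : positions_S s' -> bit (m (2 ^ s')) t' -> positions_T t'.
  move=> Ss'; have : base_set (2 ^ s') by exists s'.
  by move=> /mA[[_ /bits_inP]|/= ->]; [apply|rewrite /bit div0n].
pose g s t := positions_S s && bit (m (2 ^ s)) t.
have gP s' t' : g s' t' ->
    [/\ positions_S s', positions_T t', s' < n & t' < n].
  (* Both bounds come from [m (2 ^ s') * 2 ^ s' <= n], as [s' < 2 ^ s'] and [t' < m (2 ^ s')]. *)
  move=> /andP[Ss' b]; split=> //; first exact: mT b.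
    have := bit_lt _ _ b; have := ltn_expl s' (isT : 1 < 2).
    case: (eqVneq (m (2 ^ s')) 0) => [->|/le]; first by lia.
    nia.
  have := bit_lt _ _ b; have := ltn_expl s' (isT : 1 < 2).
  case: (eqVneq (m (2 ^ s')) 0) => [->|/le]; first by lia.
  nia.
have := sum_exp2_mask (predC odd) g n gP.
have -> : \sum_(s' < n) (\sum_(t' < n) g s' t' * 2 ^ t') * 2 ^ s' = n.
  rewrite [RHS]en (sum_finsupp_exp2 m n); last first.
    move=> a ma; have [s' Ss' e] := supp _ ma; exists s' => //.
    by have := le _ ma; have := ltn_expl s' (isT : 1 < 2); rewrite -e; nia.
  apply: eq_bigr => s' _; congr (_ * _).
  have [m0|m0] := eqVneq (m (2 ^ s')) 0.
    by rewrite m0 big1// => t' _; rewrite /g m0 /bit div0n andbF.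
  have [s'' Ss'' /eqP] := supp _ m0; rewrite eqn_exp2l// => /eqP es.
  rewrite -[RHS](sum_bit _ n); last first.
    by apply: leq_trans (le _ m0); rewrite leq_pmulr// expn_gt0.
  by apply: eq_bigr => t' _; rewrite /g es Ss''.
(* The expansion with digits [g] replaces the [n] in [bit n (s + t)], so this digit can be read
   off. *)
move=> {1}->.
pose f k := g (mask (predC odd) k) (mask (predC (predC odd)) k).
rewrite (bit_sum f) /f.
have [Tt|/negP nT] := boolP (positions_T t); last first.
  by apply/negP => /(mT _ _ Ss).
rewrite mask_add// maskC_add// /= /g Ss /=.
case: (boolP (bit _ _)) => [b|]; last by rewrite andbF.
by have [|_ _ ? ?] := gP s t; rewrite ?/g ?Ss// andbT; lia.
Qed.

(** The coefficient [h s] of [2 ^ s] collects the digits of [n] at positions [s + t] and moves them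
    to [t]. *)
Lemma exists_representation n :
  exists m, representations n base_set coef_set m.
Proof.
pose g s t := [&& positions_S s, positions_T t & bit n (s + t)].
pose h s := \sum_(t < n) g s t * 2 ^ t.
(* Exponents below [n] suffice: [bit n (s + t)] is false once [s >= n], so the default 0 agrees with
   [h s]. [trunc_log 2] recovers [s] from [2 ^ s]. *)
pose F : {fset nat} := [fset 2 ^ s | s in iota 0 n]%fset.
pose m : coefs := [fsfun a in F => h (trunc_log 2 a)].
have gP s t : g s t -> [/\ positions_S s, positions_T t, s < n & t < n].
  by move=> /and3P[Ss Tt /bit_lt b]; split=> //; lia.
have mE s : m (2 ^ s) = h s.
  rewrite fsfunE trunc_expnK//; case: ifPn => // sF; rewrite [RHS]big1// => t _.
  case: (boolP (g s t)) => // /gP[_ _ sn _].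
  by case/imfsetP: sF; exists s => //=; rewrite mem_iota.
have h0 s : ~~ positions_S s -> h s = 0.
  by move=> Ss; apply: big1 => t _; rewrite /g (negbTE Ss).
have supp a : m a != 0 -> exists2 s, s < n & a = 2 ^ s.
  rewrite fsfunE; case: ifP => // /imfsetP[s /=]; rewrite mem_iota => sn -> _.
  by exists s.
exists m; split.
- move=> _ [s /= Ss <-]; rewrite mE.
  have [->|h1] := posnP (h s); [by right|left; split=> //].
  by apply/bits_inP => k; rewrite (bit_sum (g s)) => /andP[_ /and3P[]].
- move=> a Aa; apply/eqP/contraT => ma; have [s _ e] := supp _ ma.
  rewrite e mE h0 ?eqxx// in ma.
  by apply/negP => Ss; apply: Aa; rewrite e; exists s.
- rewrite (sum_finsupp_exp2 m n)//.
  under eq_bigr do rewrite mE.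
  rewrite (sum_exp2_mask (predC odd) g n gP) -[LHS](sum_bit n (n + n)) ?leq_addr//.
  (* The two masks of [k] lie in S and T and add up to [k], so the digit is [bit n k]. *)
  by apply: eq_bigr => k _; rewrite /g maskD /positions_S /positions_T !bits_in_mask.
Qed.

Theorem theorem1p1 :
  exists A M : set nat,
    [/\ infinite_set A, infinite_set M,
        forall a, A a -> 0 < a,
        forall m, M m -> 0 < m &
        forall n : nat, 0 < n -> p n A M = 1].
Proof.
have exp2I : injective (expn 2) by move=> x y /eqP; rewrite eqn_exp2l// => /eqP.
exists base_set, coef_set; split.
(* The exponent [2 ^ j.*2] has its single digit 1 at an even position, so it lies in S. *)
- apply: (infinite_set_range (fun j => 2 ^ (2 ^ j.*2))) => [x y|j].
    by do 2 move/exp2I; exact: double_inj.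
  by exists (2 ^ j.*2) => //=; apply: bits_in_exp2; rewrite /= odd_double.
(* Likewise [2 ^ j.*2.+1] lies in T, and it is the only digit position of the witness. *)
- apply: (infinite_set_range (fun j => 2 ^ (2 ^ j.*2.+1))) => [x y|j].
    by do 2 move/exp2I; move=> [] /double_inj.
  split; first by rewrite expn_gt0.
  by do 2 apply: bits_in_exp2; rewrite /= odd_double.
- by move=> _ [s _ <-]; rewrite expn_gt0.
- by move=> m [].
- move=> n _; have [m mP] := exists_representation n.
  rewrite /p; suff -> : representations n base_set coef_set = [set m].
    by rewrite fset_set1 cardfs1.
  apply/seteqP; split => [m' m'P|_ ->//] /=; apply/fsfunP => a.
  (* Outside A both families vanish; on A they agree digit by digit. *)
  have [[s /= Ss <-]|Aa] := pselect (base_set a); last first.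
    by case: mP m'P => _ mN _ [_ m'N _]; rewrite mN// m'N.
  apply: bit_inj; apply/funext => t.
  by rewrite (representation_bit n m')// (representation_bit n m).
Qed.
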